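(* Let $a>0$, let $\psi_a:X\times X\to\mathbb{R}$ be the regularized Nikaido-Isoda function, and suppose that $\psi_a(\cdot,y)$ is a convex function for every $y\in X$. Then the set of normalized Nash equilibria $X^*\subseteq X$ fulfills the weak sharpness property if and only if there exists $\gamma>0$ such that $$V_a(x)\ \geq\ \gamma\, d(x,X^* )\quad\text{for all } x\in X .$$
   Context: Setting (jointly convex generalized Nash equilibrium problem). There are $N$ players; player $i$ controls $x_i\in\mathbb{R}^{n_i}$, with $\sum_{i=1}^N n_i=n$, and $x=(x_1,\dots,x_N)=(x_{-i},x_i)\in\mathbb{R}^n$, where $x_{-i}\in\mathbb{R}^{n-n_i}$ collects the strategies of all players other than $i$. Given $x_{-i}$, player $i$ minimizes $\theta_i(x_{-i},\cdot)$ over $K_i(x_{-i})=\{x_i\in\mathbb{R}^{n_i} : (x_{-i},x_i)\in X\}$. Standing assumptions: (A1) $X\subseteq\mathbb{R}^n$ is non-empty, closed and convex; (A2) for each $i$, the loss function $\theta_i:\mathbb{R}^{n-n_i}\times\mathbb{R}^{n_i}\to\mathbb{R}$ is continuously differentiable, and $\theta_i(x_{-i},\cdot)$ is convex for each $x_{-i}\in\mathbb{R}^{n-n_i}$. Define $F:\mathbb{R}^n\to\mathbb{R}^n$ by $F(x)=(\nabla_{x_1}\theta_1(x),\dots,\nabla_{x_N}\theta_N(x))$, where $\nabla_{x_i}$ is the partial gradient with respect to $x_i$. A normalized Nash equilibrium (NNE) is a point $x^*\in X$ with $\langle F(x^* ),y-x^*\rangle\ge 0$ for all $y\in X$; $X^*$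 denotes the set of all NNE. For $a>0$, the regularized Nikaido-Isoda function $\psi_a:X\times X\to\mathbb{R}$ is $$\psi_a(x,y)=\sum_{i=1}^N\Big[\theta_i(x_{-i},x_i)-\theta_i(x_{-i},y_i)-\tfrac a2\|x_i-y_i\|^2\Big],$$ and the regularized gap function is $V_a(x)=\max_{y\in X}\psi_a(x,y)$ for $x\in X$. For a non-empty set $S\subseteq\mathbb{R}^n$, $S^\circ=\{v\in\mathbb{R}^n : \langle v,z\rangle\le 0\ \forall z\in S\}$ is its polar (and the polar of the empty set is $\mathbb{R}^n$); for a closed convex set $S$ and $x\in S$, the normal cone is $N_S(x)=(S-x)^\circ=\{v:\langle v,z-x\rangle\le 0\ \forall z\in S\}$ and the tangent cone is $T_S(x)=[N_S(x)]^\circ$. $B$ is the unit ball of $\mathbb{R}^n$, $\|\cdot\|$ is the Euclidean norm, and $d(x,S)=\inf_{z\in S}\|x-z\|$. Weak sharpness property: $X^*$ fulfills the weak sharpness property if there exists $\gamma>0$ such that $$-F(x^* )+\gamma B\ \subseteq\ \bigcap_{x\in X^*}\big[T_X(x)\cap N_{X^*}(x)\big]^\circ\quad\text{for all }x^*\in X^* .$$ *)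

(* Defs.v *)
From HB Require Import structures.
From mathcomp Require Import all_boot all_order all_algebra.
From mathcomp Require Import all_classical all_reals all_analysis.

Set Implicit Arguments.
Unset Strict Implicit.
Unset Printing Implicit Defensive.

Import Order.TTheory GRing.Theory Num.Theory.
Import numFieldNormedType.Exports.

Local Open Scope classical_set_scope.
Local Open Scope ring_scope.

Section Euclidean.
Context {R : realType} {k : nat}.
Implicit Types (u v x : 'rV[R]_k) (S : set 'rV[R]_k) (f : 'rV[R]_k -> R).

Definition dotp u v : R := \sum_(j < k) u 0 j * v 0 j.

(* The library norm `|u| on 'rV[R]_k is the sup norm; it induces the same
   topology, but metric quantities below use the Euclidean norm. *)
Definition enorm u : R := Num.sqrt (dotp u u).

(* Extended-real valued, so that the distance to the empty set is +oo. *)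
Definition edistance x S : \bar R :=
  ereal_inf [set (enorm (x - z))%:E | z in S].

(* For S = set0 this is the whole space. *)
Definition polar S : set 'rV[R]_k :=
  [set v | forall z, S z -> dotp v z <= 0].

Definition normal_cone S x : set 'rV[R]_k := polar [set z - x | z in S].

Definition tangent_cone S x : set 'rV[R]_k := polar (normal_cone S x).

Definition gradient f x : 'rV[R]_k := \row_(j < k) 'D_(delta_mx 0 j) f x.

Definition continuously_differentiable f : Prop :=
  (forall x, differentiable f x) /\ continuous (gradient f).

End Euclidean.

Section Game.
(* The N players' strategies are the blocks submxrow x i : 'rV[R]_(n i) of a
   row vector x of length \sum_i n i.  The loss theta i takes the whole
   profile x = (x_{-i}, x_i). *)
Context {R : realType} {N : nat} {n : 'I_N -> nat}.
Implicit Types (x y : 'rV[R]_(\sum_(i < N) n i))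
  (X : set 'rV[R]_(\sum_(i < N) n i))
  (theta : 'I_N -> 'rV[R]_(\sum_(i < N) n i) -> R).

(* The profile (x_{-i}, z). *)
Definition deviate x (i : 'I_N) (z : 'rV[R]_(n i)) :
    'rV[R]_(\sum_(i < N) n i) :=
  \mxrow_(j < N) dfwith (fun l => submxrow x l) i z j.

Definition partial_gradient theta (i : 'I_N) x : 'rV[R]_(n i) :=
  gradient (fun z => theta i (deviate x z)) (submxrow x i).

Definition pseudo_gradient theta x : 'rV[R]_(\sum_(i < N) n i) :=
  \mxrow_(i < N) partial_gradient theta i x.

Definition NNE X theta : set 'rV[R]_(\sum_(i < N) n i) :=
  [set xs | X xs /\
     forall y, X y -> 0 <= dotp (pseudo_gradient theta xs) (y - xs)].

Definition psi theta (a : R) x y : R :=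
  \sum_(i < N) (theta i x - theta i (deviate x (submxrow y i))
                - a / 2 * enorm (submxrow x i - submxrow y i) ^+ 2).

(* When a > 0, X is nonempty and closed and the losses are continuous and
   convex in the player's own strategy, the supremum is an attained, finite
   maximum. *)
Definition regularized_gap X theta (a : R) x : \bar R :=
  ereal_sup [set (psi theta a x y)%:E | y in X].

Definition weak_sharpness X theta : Prop :=
  exists2 gamma : R, 0 < gamma &
    forall xs, NNE X theta xs ->
      [set - pseudo_gradient theta xs + gamma *: u | u in [set u | enorm u <= 1]]
      `<=` \bigcap_(x in NNE X theta)
             polar (tangent_cone X x `&` normal_cone (NNE X theta) x).

End Game.

(* Main.v *)
From HB Require Import structures.
Require Import Defs.
From mathcomp Require Import all_boot all_order all_algebra.
From mathcomp Require Import all_classical all_reals all_analysis.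
From mathcomp Require Import ring lra.
Import Order.TTheory GRing.Theory Num.Theory.
Import numFieldNormedType.Exports.
Local Open Scope classical_set_scope.
Local Open Scope ring_scope.

(** Why the theorem holds.

    Write psi = psi_a and F for the pseudo-gradient.  Three facts about psi
    carry the proof: it vanishes on the diagonal; psi(., y) is convex by
    hypothesis and psi(x, .) is strongly concave with modulus a; its partial
    derivatives at a diagonal point (x, x) are F(x) and - F(x).  They are
    packaged as [gap_bifunction], and the game is used again only to verify
    this package in [psi_gap_bifunction].

    Tangents at diagonal points give
      <F(y), x - y> <= psi(x, y) <= - <F(x), y - x> - (a / 4) |x - y|^2,
    the content of [gap_lower_bound] and [gap_upper_bound].  Hence F is
    strongly monotone on X and an equilibrium is unique.

    The tool for the rest is a one-sided Danskin inequality,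
    [gap_danskin]: if yb maximises psi(xb, .) over X and V_a grows at rate at
    least c from xb towards x, then c <= psi(x, yb) - psi(xb, yb).
    At a minimiser xb of V_a, with x = yb and c = 0, it gives V_a(xb) <= 0, so
    an equilibrium exists ([gap_solution_exists]).  The set of equilibria is
    thus a singleton {xs}; in particular the distance to it is finite.

    For a singleton, weak sharpness with constant g is the linear growth
      g |x - xs| <= <F(xs), x - xs>   for all x in X
    ([sharp_cone_growth]).  Linear growth implies the error bound because
    <F(xs), x - xs> <= psi(x, xs) <= V_a(x).  Conversely, given the error
    bound, Danskin's inequality at xs, where the maximiser is xs itself, yields
    g |x - xs| <= psi(x, xs) on X, and differentiating along the segment from
    xs to x gives linear growth ([gap_error_bound_slope]).  Both implications
    keep the same constant g. *)

Set Implicit Arguments.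
Unset Strict Implicit.

(** * Euclidean geometry of row vectors *)

Section EuclideanFacts.
Context {R : realType} {k : nat}.
Implicit Types (u v w : 'rV[R]_k) (c : R).

Lemma dotpC u v : dotp u v = dotp v u.
Proof. by apply: eq_bigr => j _; rewrite mulrC. Qed.

Lemma dotpDl u v w : dotp (u + v) w = dotp u w + dotp v w.
Proof. by rewrite -big_split; apply: eq_bigr => j _; rewrite mxE mulrDl. Qed.

Lemma dotpZl c u v : dotp (c *: u) v = c * dotp u v.
Proof. by rewrite [RHS]mulr_sumr; apply: eq_bigr => j _; rewrite mxE mulrA. Qed.

Lemma dotpNl u v : dotp (- u) v = - dotp u v.
Proof. by rewrite -scaleN1r dotpZl mulN1r. Qed.

Lemma dotpDr u v w : dotp u (v + w) = dotp u v + dotp u w.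
Proof. by rewrite dotpC dotpDl !(dotpC u). Qed.

Lemma dotpZr c u v : dotp u (c *: v) = c * dotp u v.
Proof. by rewrite dotpC dotpZl dotpC. Qed.

Lemma dotpNr u v : dotp u (- v) = - dotp u v.
Proof. by rewrite dotpC dotpNl dotpC. Qed.

Lemma dotp0r u : dotp u 0 = 0.
Proof. by rewrite -(scale0r 0) dotpZr mul0r. Qed.

Lemma dotpvv_ge0 u : 0 <= dotp u u.
Proof. by apply: sumr_ge0 => j _; rewrite -expr2 sqr_ge0. Qed.

Lemma enorm_ge0 u : 0 <= enorm u.
Proof. exact: sqrtr_ge0. Qed.

Lemma sqr_enorm u : enorm u ^+ 2 = dotp u u.
Proof. by rewrite sqr_sqrtr ?dotpvv_ge0. Qed.

Lemma enormZ c u : 0 <= c -> enorm (c *: u) = c * enorm u.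
Proof.
move=> c0; rewrite /enorm dotpZl dotpZr mulrA -expr2.
by rewrite sqrtrM ?sqr_ge0// sqrtr_sqr ger0_norm.
Qed.

Lemma supnorm_coord u j : `|u 0 j| <= `|u|.
Proof.
rewrite [leRHS]/Num.norm /= mx_normrE.
by apply/bigmax_geP; right; exists (0, j).
Qed.

(** The topology comes from the sup norm, which the Euclidean norm
    dominates; this turns Euclidean estimates into topological ones. *)
Lemma sqr_supnorm_le_dotp u : `|u| ^+ 2 <= dotp u u.
Proof.
have [->|u0] := eqVneq `|u| 0; first by rewrite expr0n dotpvv_ge0.
have [[i j] nu] := mx_norm_neq0 u0.
rewrite [`|u|]nu /= {i nu}ord1.
rewrite real_normK ?num_real// /dotp (bigD1 j)//= -expr2 lerDl.
by apply: sumr_ge0 => l _; rewrite -expr2 sqr_ge0.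
Qed.

Lemma dotpvv_eq0 u : dotp u u <= 0 -> u = 0.
Proof.
move=> uu; apply/eqP; rewrite -normr_eq0 -sqrf_eq0 eq_le sqr_ge0 andbT.
exact: le_trans (sqr_supnorm_le_dotp u) uu.
Qed.

Lemma enorm0 : enorm (0 : 'rV[R]_k) = 0.
Proof. by rewrite /enorm dotp0r sqrtr0. Qed.

Lemma enorm_eq0 u : enorm u = 0 -> u = 0.
Proof. by move=> u0; apply: dotpvv_eq0; rewrite -sqr_enorm u0 expr0n. Qed.

Lemma cauchy_schwarz u v : dotp u v <= enorm u * enorm v.
Proof.
have [/enorm_eq0->|u0] := eqVneq (enorm u) 0.
  by rewrite dotpC dotp0r enorm0 mul0r.
have [/enorm_eq0->|v0] := eqVneq (enorm v) 0.
  by rewrite dotp0r enorm0 mulr0.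
have uv0 : 0 < 2 * (enorm u * enorm v).
  by rewrite mulr_gt0// mulr_gt0// lt_neqAle eq_sym enorm_ge0 ?u0 ?v0.
(* the square of | |v| u - |u| v | is nonnegative *)
have := dotpvv_ge0 (enorm v *: u - enorm u *: v).
rewrite !(dotpDl, dotpDr, dotpNl, dotpNr, dotpZl, dotpZr) -!sqr_enorm.
rewrite (dotpC v u) => h; rewrite -subr_ge0 -(pmulr_rge0 _ uv0).
by apply: le_trans h _; rewrite le_eqVlt; apply/orP; left; apply/eqP; ring.
Qed.

(** Completing the square: a quadratic with positive leading coefficient has
    bounded sublevel sets. *)
Lemma quadratic_sublevel_bounded (A : set 'rV[R]_k)
    (b x0 : 'rV[R]_k) (q c : R) :
  0 < q ->
  (forall x, A x -> dotp b (x - x0) + q * dotp (x - x0) (x - x0) <= c) ->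
  bounded_set A.
Proof.
move=> q0 Ac; pose K := 2 * (c / q + dotp b b / (2 * q ^+ 2)).
have K0 x : A x -> `|x - x0| ^+ 2 <= K.
  move=> /Ac; move: (x - x0) => u h; apply: le_trans (sqr_supnorm_le_dotp u) _.
  have := dotpvv_ge0 (b + q *: u).
  rewrite !(dotpDl, dotpDr, dotpZl, dotpZr) (dotpC u b) => h2.
  have -> : K = (2 * q * c + dotp b b) / q ^+ 2.
    by rewrite /K; field; rewrite gt_eqF.
  by rewrite ler_pdivlMr ?exprn_gt0//; nra.
exists (K + 1 + `|x0|); split; first exact: num_real.
move=> M KM x Ax; apply: le_trans (ltW KM).
rewrite -{1}(subrK x0 x); apply: le_trans (ler_normD _ _) _; rewrite lerD2r.
have := K0 x Ax; have := normr_ge0 (x - x0); set r := `|x - x0|; nra.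
Qed.

Lemma edistance_set1 u v :
  edistance u [set v] = (enorm (u - v))%:E.
Proof. by rewrite /edistance image_set1 ereal_inf1. Qed.

End EuclideanFacts.

(** * Minimisation, convexity and derivatives *)

(** Weierstrass for lower semicontinuous functions: the sublevel sets at the
    values taken form a chain of closed sets, so by compactness they have a
    common point. *)
Lemma compact_lsc_min (T : topologicalType) (R : realType) (A : set T)
    (f : T -> R) :
  compact A -> A !=set0 -> (forall c, closed (A `&` [set x | f x <= c])) ->
  exists2 x, A x & forall y, A y -> f x <= f y.
Proof.
move=> cA [x0 Ax0] clf; pose B y := A `&` [set x | f x <= f y].
have FF : ProperFilter (filter_from A B).
  apply: filter_from_proper; last by move=> y Ay; exists y; split => /=.
  apply: filter_from_filter; first by exists x0.
  move=> i j Ai Aj; have [ij|/ltW ji] := leP (f i) (f j).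
    by exists i => // x [Ax /= fx]; split; split => //=; exact: le_trans fx ij.
  by exists j => // x [Ax /= fx]; split; split => //=; exact: le_trans fx ji.
have FA : filter_from A B A by exists x0 => // x [].
have [p [Ap clp]] := cA _ FF FA.
exists p => // y Ay; have : closure (B y) p.
  by move=> U /clp; apply; exists y.
by rewrite -(closure_id (B y)).1; [case|exact: clf].
Qed.

Lemma lsc_coercive_min (R : realType) (k : nat) (X : set 'rV[R]_k)
    (f : 'rV[R]_k -> R) :
  X !=set0 -> (forall c, closed (X `&` [set x | f x <= c])) ->
  (forall c, bounded_set (X `&` [set x | f x <= c])) ->
  exists2 x, X x & forall y, X y -> f x <= f y.
Proof.
move=> [x0 Xx0] clf bdf; pose A := X `&` [set x | f x <= f x0].
have [] := @compact_lsc_min _ _ A f.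
- by apply: bounded_closed_compact; [exact: bdf|exact: clf].
- by exists x0; split => /=.
- move=> c; rewrite [X in closed X](_ : _ =
      X `&` [set x | f x <= Num.min (f x0) c]).
    exact: clf.
  apply/seteqP; split=> x; rewrite /A /= le_min.
    by move=> [[Xx ->] ->].
  by move=> [Xx /andP[]].
- move=> x [Xx /= xx0] xmin; exists x => // y Xy.
  have [yx0|/ltW x0y] := leP (f y) (f x0); first exact: xmin.
  exact: le_trans x0y.
Qed.

(** Slope comparison: a derivative inherits a one-sided bound on the
    difference quotients. *)
Lemma is_derive_le (R : realType) (f : R -> R) (l c : R) :
  is_derive (0 : R) 1 f l -> (forall t, 0 < t < 1 -> f t - f 0 <= t * c) ->
  l <= c.
Proof.
move=> [df <-] fc; rewrite leNgt; apply/negP => cl.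
have : \forall h \near 0^', c < h^-1 *: (f (h *: 1 + 0) - f 0).
  exact: cvgr_gt cl.
move=> /nbhs_ballP[e /= e0 he]; pose h := Num.min e 1 / 2.
have h0 : 0 < h by rewrite divr_gt0// lt_min e0 ltr01.
have he1 : h < Num.min e 1 by rewrite gtr_pMr ?lt_min ?e0//; lra.
move: he1; rewrite lt_min => /andP[hle h1].
have := he h; rewrite /ball /= sub0r normrN gtr0_norm// => /(_ hle).
rewrite gt_eqF// => /(_ isT); rewrite addr0 [h *: 1]mulr1 => /lt_geF.
by rewrite [_ *: _]mulrC ler_pdivrMr// [c * h]mulrC fc// h0.
Qed.

Lemma is_derive_ge (R : realType) (f : R -> R) (l c : R) :
  is_derive (0 : R) 1 f l -> (forall t, 0 < t < 1 -> t * c <= f t - f 0) ->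
  c <= l.
Proof.
move=> df fc; rewrite -lerN2; apply: (is_derive_le (is_deriveN df)) => t t01.
by rewrite mulrN -opprD lerN2 fc.
Qed.

Lemma convE_segment (R : realType) (E : lmodType R) (t : {i01 R})
    (x y : convex_lmodType E) :
  conv t y x = (x : E) + t%:num *: ((y : E) - (x : E)).
Proof.
rewrite /conv /= scalerBr [X in _ + X]scalerBl scale1r.
by rewrite addrCA addrA.
Qed.

Lemma convex_segment {R : realType} {k : nat} (X : set 'rV[R]_k) x y t :
  convex_set X -> X x -> X y -> 0 < t < 1 -> X (x + t *: (y - x)).
Proof.
move=> cX Xx Xy /andP[t0 t1].
have := cX y x (Itv01 (ltW t0) (ltW t1)).
by rewrite convE_segment !inE /=; apply.
Qed.

Lemma convex_function_segment {R : realType} {k : nat} (X : set 'rV[R]_k)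
    (f : 'rV[R]_k -> R) x y t :
  convex_function X f -> X x -> X y -> 0 < t < 1 ->
  f (x + t *: (y - x)) <= (1 - t) * f x + t * f y.
Proof.
move=> cf Xx Xy /andP[t0 t1].
have := cf (Itv01 (ltW t0) (ltW t1)) y x; rewrite !inE => /(_ Xy Xx).
rewrite convE_segment /= => /le_trans; apply.
by rewrite addrC.
Qed.

Lemma is_derive_line (R : realType) (k : nat) (f : 'rV[R]_k -> R) x d :
  differentiable f x ->
  is_derive (0 : R) 1 (fun t => f (x + t *: d)) ('d f x d).
Proof.
move=> df; rewrite -deriveE//.
have quotient : (fun h : R => h^-1 *: (((fun t => f (x + t *: d)) \o shift 0)
    (h *: 1) - f (x + 0 *: d))) =
    (fun h => h^-1 *: ((f \o shift x) (h *: d) - f x)).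
  apply/funext => h /=; rewrite addr0 scale0r addr0 [h *: 1]mulr1.
  by rewrite [h *: d + x]addrC.
by split; rewrite /derivable /derive quotient//; exact: diff_derivable.
Qed.

Lemma continuous_sum (R : realType) (T : topologicalType) (m : nat)
    (f : 'I_m -> T -> R) x :
  (forall i, {for x, continuous (f i)}) ->
  {for x, continuous (fun x => \sum_(i < m) f i x)}.
Proof.
by move=> cf; apply: cvg_big => [|i _]; [exact: add_continuous|exact: cf].
Qed.

Lemma continuous_sqdist (R : realType) (k : nat) :
  continuous (fun u : 'rV[R]_k => dotp u u).
Proof.
move=> u; apply: continuous_sum => j.
by apply: continuousM; exact: coord_continuous.
Qed.

Lemma is_derive_sq_scale (R : realType) (b c : R) :
  is_derive (0 : R) 1 (fun t => b * t ^+ 2 * c) (b * 0 * c).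
Proof.
rewrite (_ : (fun t => _) = (b * c) *: (id : R -> R) ^+ 2); last first.
  by apply/funext => t; rewrite !fctE mulrAC.
by apply: is_derive_eq; rewrite /= expr1 mulr0 scale0r scaler0 mulr0 mul0r.
Qed.

(** * Convex-concave bifunctions vanishing on the diagonal *)

(** What the proof uses of the Nikaido-Isoda function: [psi] is a
    convex-concave bifunction vanishing on the diagonal, with modulus [a] of
    strong concavity, whose two partial derivatives at a diagonal point are
    [F] and [- F]. *)
Record gap_bifunction {R : realType} {k : nat} (X : set 'rV[R]_k)
    (psi : 'rV[R]_k -> 'rV[R]_k -> R) (F : 'rV[R]_k -> 'rV[R]_k) (a : R) :
    Prop := GapBifunction {
  gap_diag : forall x, psi x x = 0;
  gap_convexl : forall x x' y t, X x -> X x' -> X y -> 0 < t < 1 ->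
    psi (x + t *: (x' - x)) y <= (1 - t) * psi x y + t * psi x' y;
  gap_concaver : forall x y y' t, 0 < t < 1 ->
    (1 - t) * psi x y + t * psi x y'
      + a / 2 * (t * (1 - t)) * dotp (y' - y) (y' - y)
    <= psi x (y + t *: (y' - y));
  gap_continuousl : forall y, continuous (psi^~ y);
  gap_continuousr : forall x, continuous (psi x);
  gap_derivel : forall x d,
    is_derive (0 : R) 1 (fun t => psi (x + t *: d) x) (dotp (F x) d);
  gap_deriver : forall x d,
    is_derive (0 : R) 1 (fun t => psi x (x + t *: d)) (- dotp (F x) d) }.

Definition variational_solutions {R : realType} {k : nat}
    (X : set 'rV[R]_k) (F : 'rV[R]_k -> 'rV[R]_k) : set 'rV[R]_k :=
  [set xs | X xs /\ forall y, X y -> 0 <= dotp (F xs) (y - xs)].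

Section GapBifunction.
Context {R : realType} {k : nat} {X : set 'rV[R]_k}.
Context {psi : 'rV[R]_k -> 'rV[R]_k -> R} {F : 'rV[R]_k -> 'rV[R]_k} {a : R}.
Implicit Types x y : 'rV[R]_k.

(** Convexity puts [psi^~ y] above its tangent at [y], whose slope is [F y]. *)
Lemma gap_lower_bound x y : gap_bifunction X psi F a -> X x -> X y ->
  dotp (F y) (x - y) <= psi x y.
Proof.
move=> gb Xx Xy; apply: is_derive_le (gap_derivel gb y (x - y)) _ => t t01.
rewrite scale0r addr0 (gap_diag gb) subr0.
by have := gap_convexl gb Xy Xx Xy t01; rewrite (gap_diag gb) mulr0 add0r.
Qed.

(** Strong concavity between [x] and the midpoint of [x] and [y], where
    [psi x] lies below its tangent at [x], whose slope is [- F x]. *)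
Lemma gap_upper_bound x y : 0 < a -> gap_bifunction X psi F a ->
  psi x y + a / 4 * dotp (y - x) (y - x) <= - dotp (F x) (y - x).
Proof.
move=> a0 gb; have ub z : psi x z <= - dotp (F x) (z - x).
  apply: is_derive_ge (gap_deriver gb x (z - x)) _ => t t01.
  rewrite scale0r addr0 (gap_diag gb) subr0.
  apply: le_trans (gap_concaver gb _ _ _ t01).
  rewrite (gap_diag gb) mulr0 add0r lerDl mulr_ge0 ?dotpvv_ge0//.
  by case/andP: t01 => t0 t1; rewrite !mulr_ge0// ?ltW ?subr_gt0//.
have half01 : 0 < (2^-1 : R) < 1 by lra.
have := ub (x + 2^-1 *: (y - x)); rewrite addrAC subrr add0r dotpZr.
have := gap_concaver gb x x y half01; rewrite (gap_diag gb).
set D := dotp (y - x) _; lra.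
Qed.

(** Stampacchia solutions are the zeros of the gap function: one direction
    is the tangent bound in the second variable, the other comes from
    differentiating [psi xs <= 0 = psi xs xs] along feasible segments. *)
Lemma gap_solutionP xs : 0 < a -> gap_bifunction X psi F a -> convex_set X ->
  variational_solutions X F xs <-> X xs /\ forall y, X y -> psi xs y <= 0.
Proof.
move=> a0 gb cX; split=> -[Xxs H]; split=> // y Xy.
  have := gap_upper_bound xs y a0 gb; have := H y Xy.
  by have := dotpvv_ge0 (y - xs); set D := dotp (y - xs) _; nra.
rewrite -oppr_le0; apply: is_derive_le (gap_deriver gb xs (y - xs)) _ => t t01.
rewrite scale0r addr0 (gap_diag gb) subr0 mulr0; apply: H.
exact: convex_segment.
Qed.

(** At a solution the gap is strictly negative off the diagonal, whereas the
    tangent bound at another solution makes it nonnegative there. *)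
Lemma gap_solution_unique x y : 0 < a -> gap_bifunction X psi F a ->
  variational_solutions X F x -> variational_solutions X F y -> x = y.
Proof.
move=> a0 gb [Xx Hx] [Xy Hy]; apply/eqP; rewrite eq_sym -subr_eq0.
apply/eqP/dotpvv_eq0.
have := gap_lower_bound gb Xx Xy; have := gap_upper_bound x y a0 gb.
have := Hx y Xy; have := Hy x Xx; set D := dotp (y - x) (y - x); nra.
Qed.

(** The quadratic upper bound makes [- psi x] coercive. *)
Lemma gap_argmax x : 0 < a -> gap_bifunction X psi F a ->
  X !=set0 -> closed X ->
  exists2 y, X y & forall z, X z -> psi x z <= psi x y.
Proof.
move=> a0 gb X0 clX.
have [||y Xy ymax] := @lsc_coercive_min _ _ X (fun y => - psi x y) X0.
- move=> c; apply: closedI clX _.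
  apply: (@closed_comp _ _ (fun y => - psi x y) [set z | z <= c]).
    by move=> z _; apply: continuousN; exact: (gap_continuousr gb).
  exact: closed_le.
- move=> c; apply: (@quadratic_sublevel_bounded _ _ _ (F x) x (a / 4) c).
    by rewrite divr_gt0.
  move=> y [_ /= yc]; have := gap_upper_bound x y a0 gb; lra.
by exists y => // z Xz; rewrite -lerN2; exact: ymax.
Qed.

(** One-sided Danskin inequality: at a maximiser [yb] of [psi xb], the slope
    of the gap function towards [x] is at most the slope of [psi^~ yb]
    measured by the chord.  Left convexity bounds the gap at the points
    [xb + t *: (x - xb)] by a mean of the values at [xb] and [x], strong
    concavity forces the maximisers at these points to converge to [yb], and
    continuity of [psi x] concludes.  The growth of the gap function is
    witnessed by points [y] of large value, so that the supremum itself need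
    not be named. *)
Lemma gap_danskin xb yb x c : 0 < a -> gap_bifunction X psi F a ->
  X !=set0 -> closed X -> convex_set X -> X xb -> X yb ->
  (forall y, X y -> psi xb y <= psi xb yb) -> X x ->
  (forall t, 0 < t < 1 -> exists2 y, X y &
     psi xb yb + t * c <= psi (xb + t *: (x - xb)) y) ->
  c <= psi x yb - psi xb yb.
Proof.
move=> a0 gb X0 clX cX Xxb Xyb ymax Xx slope.
have [ym Xym Mmax] := gap_argmax x a0 gb X0 clX.
have half01 : 0 < (2^-1 : R) < 1 by lra.
have quad y : X y -> psi xb y + a / 4 * dotp (y - yb) (y - yb) <= psi xb yb.
  move=> Xy; have := gap_concaver gb xb yb y half01.
  have := ymax _ (convex_segment cX Xyb Xy half01).
  set D := dotp _ _; lra.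
rewrite leNgt; apply/negP => lt_c; pose s := c + psi xb yb.
have near_t t : 0 < t < 1 -> exists2 y, X y &
    (s <= psi x y) /\
    (1 - t) * (a / 4 * dotp (y - yb) (y - yb)) <= t * (psi x y - s).
  move=> t01; have [y Xy sy] := slope t t01; exists y => //.
  have cy := gap_convexl gb Xxb Xx Xy t01; have qy := quad y Xy.
  have D0 : 0 <= a / 4 * dotp (y - yb) (y - yb).
    by rewrite mulr_ge0 ?dotpvv_ge0// divr_ge0// ltW.
  move: cy qy D0 sy; set D := a / 4 * _; set p := psi x y; set q := psi xb y.
  set r := psi _ y; move: t01 => /andP[t0 t1]; rewrite /s => cy qy D0 sy.
  have le2 : (1 - t) * D <= t * (p - (c + psi xb yb)) by nra.
  split=> //; rewrite -subr_ge0 -(pmulr_rge0 _ t0); apply: le_trans le2.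
  by rewrite mulr_ge0// subr_ge0 ltW.
have /nbhs_ballP[e /= e0 he] : \forall y \near yb, psi x y < s.
  have : psi x y @[y --> yb] --> psi x yb by exact: (gap_continuousr gb).
  move=> /cvgr_lt; apply; rewrite /s; lra.
have K0 : 0 <= psi x ym - s.
  have [y Xy [sy _]] := near_t _ half01.
  by rewrite subr_ge0; exact: le_trans sy (Mmax y Xy).
pose K := 8 / a * (psi x ym - s).
have {}K0 : 0 <= K by rewrite mulr_ge0// divr_ge0// ltW.
have e20 : 0 < e ^+ 2 by rewrite exprn_gt0.
(* the squared distance of the maximiser to yb is at most t * K if t <= 1 / 2 *)
pose t := e ^+ 2 / (2 * (K + e ^+ 2)).
have t0 : 0 < t by rewrite divr_gt0// mulr_gt0// ltr_wpDl.
have t12 : t <= 2^-1.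
  rewrite ler_pdivrMr ?mulr_gt0 ?ltr_wpDl// mulrA mulVf ?pnatr_eq0//.
  by rewrite mul1r lerDr.
have tK : t * K < e ^+ 2.
  rewrite mulrAC ltr_pdivrMr ?mulr_gt0 ?ltr_wpDl//.
  by rewrite ltr_pM2l//; lra.
have [|y Xy [sy Dy]] := near_t t; first by rewrite t0; lra.
have /lt_geF : psi x y < s.
  apply: he; rewrite -ball_normE /ball_ /= distrC.
  rewrite -(@ltr_pXn2r _ 2)// ?nnegrE ?(ltW e0)//.
  apply: le_lt_trans (sqr_supnorm_le_dotp _) _; apply: le_lt_trans tK.
  have := Mmax y Xy; rewrite /K; move: Dy; set D := dotp _ _ => Dy pM.
  have : 2^-1 * (a / 4 * D) <= t * (psi x ym - s).
    apply: le_trans (le_trans Dy _); last by rewrite ler_pM2l// lerD2r.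
    rewrite ler_wpM2r//; last by lra.
    by rewrite mulr_ge0 ?dotpvv_ge0// divr_ge0// ltW.
  move=> h; rewrite mulrCA.
  have -> : D = 8 / a * (2^-1 * (a / 4 * D)) by field; rewrite gt_eqF.
  by rewrite ler_pM2l// divr_gt0.
by rewrite sy.
Qed.

(** The gap function has a minimiser, by coercivity.  Danskin's inequality
    there, in the direction of a best response [yb] and with zero slope, bounds
    the minimal gap by [psi yb yb = 0], so the minimiser is a solution. *)
Lemma gap_solution_exists : 0 < a -> gap_bifunction X psi F a ->
  X !=set0 -> closed X -> convex_set X ->
  exists xs, variational_solutions X F xs.
Proof.
move=> a0 gb X0 clX cX.
pose br x := projT1 (cid2 (gap_argmax x a0 gb X0 clX)).
have Xbr x : X (br x) by rewrite /br; case: cid2.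
have brmax x y : X y -> psi x y <= psi x (br x).
  by rewrite /br; case: cid2 => ? ? /=; apply.
pose V x := psi x (br x).
have half01 : 0 < (2^-1 : R) < 1 by lra.
have [||xb Xxb Vmin] := @lsc_coercive_min _ _ X V X0.
- move=> c; rewrite [X in closed X](_ : _ =
      X `&` \bigcap_(y in X) [set x | psi x y <= c]).
    apply: closedI; [exact: clX|apply: closed_bigI => y Xy].
    apply: (@closed_comp _ _ (psi^~ y) [set z | z <= c]).
      by move=> z _; exact: (gap_continuousl gb).
    exact: closed_le.
  apply/seteqP; split=> x [Xx /= Vc]; split=> //=.
    by move=> y Xy /=; exact: le_trans (brmax x y Xy) Vc.
  exact: Vc.
- move=> c; have [x0 Xx0] := X0.
  apply: (@quadratic_sublevel_bounded _ _ _ (2^-1 *: F x0) x0 (a / 8) c).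
    by rewrite divr_gt0.
  move=> x [Xx /= Vc]; apply: le_trans Vc.
  apply: le_trans (brmax x _ (convex_segment cX Xx Xx0 half01)).
  apply: le_trans (gap_concaver gb _ _ _ half01); rewrite (gap_diag gb).
  have := gap_lower_bound gb Xx Xx0; rewrite dotpZl.
  have -> : dotp (x0 - x) (x0 - x) = dotp (x - x0) (x - x0).
    by rewrite -opprB dotpNl dotpNr opprK.
  by lra.
exists xb; apply/gap_solutionP => //; split=> // y Xy.
have : 0 <= psi (br xb) (br xb) - psi xb (br xb).
  apply: (gap_danskin a0 gb) => // [z|t t01]; first exact: brmax.
  exists (br (xb + t *: (br xb - xb))) => //; rewrite mulr0 addr0.
  by apply: Vmin; exact: convex_segment.
by rewrite (gap_diag gb) sub0r oppr_ge0; exact/le_trans/brmax.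
Qed.

(** The error bound passes to the slope at the solution: Danskin's inequality
    turns it into [g * |x - xs| <= psi x xs] on all of [X], and these values
    along a segment issued from [xs] have derivative [dotp (F xs) (x - xs)]. *)
Lemma gap_error_bound_slope xs g : 0 < a -> gap_bifunction X psi F a ->
  X !=set0 -> closed X -> convex_set X ->
  variational_solutions X F xs ->
  (forall x, X x -> exists2 y, X y & g * enorm (x - xs) <= psi x y) ->
  forall x, X x -> g * enorm (x - xs) <= dotp (F xs) (x - xs).
Proof.
move=> a0 gb X0 clX cX sol eb.
have /gap_solutionP-/(_ a0 gb cX)[Xxs xs0] := sol.
have on_segment x t : 0 < t < 1 ->
    g * enorm (xs + t *: (x - xs) - xs) = t * (g * enorm (x - xs)).
  by move=> /andP[t0 _]; rewrite addrAC subrr add0r enormZ ?ltW// mulrCA.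
have chord x : X x -> g * enorm (x - xs) <= psi x xs.
  move=> Xx; rewrite -[leRHS]subr0 -(gap_diag gb xs).
  apply: (gap_danskin a0 gb) => // [y Xy|t t01].
    by rewrite (gap_diag gb); exact: xs0.
  rewrite (gap_diag gb) add0r -on_segment//; apply: eb.
  exact: convex_segment.
move=> x Xx; apply: is_derive_ge (gap_derivel gb xs (x - xs)) _ => t t01.
rewrite scale0r addr0 (gap_diag gb) subr0 -on_segment//.
by apply: chord; exact: convex_segment.
Qed.

(** The solution set being a singleton [xs], its normal cone at [xs] is
    everything, so weak sharpness says that a ball around [- F xs] lies in the
    polar of the tangent cone.  Testing the ball against the direction
    [x - xs], which is tangent, gives linear growth; conversely linear growth
    places the ball in the normal cone, whose polar is the tangent cone. *)
Lemma sharp_cone_growth (xs : 'rV[R]_k) (v : 'rV[R]_k) g :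
  0 < g ->
  [set - v + g *: u | u in [set u | enorm u <= 1]]
    `<=` polar (tangent_cone X xs `&` normal_cone [set xs] xs) <->
  forall x, X x -> g * enorm (x - xs) <= dotp v (x - xs).
Proof.
move=> g0; have normal_xs w : normal_cone [set xs] xs w.
  by move=> _ [_ -> <-]; rewrite subrr dotp0r.
split=> [sharp x Xx|growth _ [u /= u1 <-] z [Tz _]].
  have [/enorm_eq0->|x0] := eqVneq (enorm (x - xs)) 0.
    by rewrite enorm0 mulr0 dotp0r.
  have xs0 : 0 < enorm (x - xs) by rewrite lt_neqAle eq_sym x0 enorm_ge0.
  pose u := (enorm (x - xs))^-1 *: (x - xs).
  have u1 : enorm u <= 1 by rewrite enormZ ?invr_ge0 ?enorm_ge0// mulVf.
  have := sharp (- v + g *: u).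
  have /[swap]/[apply] : [set - v + g *: u | u in [set u | enorm u <= 1]]
    (- v + g *: u) by exists u.
  move=> /(_ (x - xs)); rewrite dotpDl dotpNl !dotpZl -sqr_enorm.
  rewrite expr2 mulKf// [- _ + _]addrC subr_le0; apply; split=> //.
  by move=> w Nw; rewrite dotpC; apply: Nw; exists x.
rewrite dotpC; apply: Tz => _ [x Xx <-].
rewrite dotpDl dotpNl dotpZl [- _ + _]addrC subr_le0.
apply: le_trans (growth x Xx).
rewrite ler_pM2l//; apply: le_trans (cauchy_schwarz _ _) _.
by rewrite ler_piMl ?enorm_ge0.
Qed.

End GapBifunction.

(** * The regularized Nikaido-Isoda function *)

Section Blocks.
Context {R : realType} {N : nat} {n : 'I_N -> nat}.
Notation profile := 'rV[R]_(\sum_(i < N) n i).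
Implicit Types (x y d : profile) (theta : 'I_N -> profile -> R).

Lemma dotp_blocks x y :
  dotp x y = \sum_(i < N) dotp (submxrow x i) (submxrow y i).
Proof.
rewrite /dotp sig_big_dep/= (reindex _ tagnat.sig_bij_on)/=.
by apply: eq_bigr => l _; rewrite !mxE !tagnat.sig2K.
Qed.

Lemma submxrowZ (c : R) x i : submxrow (c *: x) i = c *: submxrow x i.
Proof. by apply/matrixP => k l; rewrite !mxE. Qed.

Definition block_embed (i : 'I_N) (z : 'rV[R]_(n i)) : profile := deviate 0 z.

Lemma block_embed_is_linear i : linear (@block_embed i).
Proof.
move=> c u v; apply/mxrowP => j.
rewrite submxrowD submxrowZ /block_embed /deviate !mxrowK.
have [<-|ij] := eqVneq i j; first by rewrite !dfwithin.
by rewrite !dfwithout// !submxrow0 scaler0 addr0.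
Qed.

HB.instance Definition _ i := GRing.isLinear.Build R 'rV[R]_(n i) profile
  *:%R (@block_embed i) (@block_embed_is_linear i).

Lemma block_embedZ i (c : R) d :
  block_embed (submxrow (c *: d) i) = c *: block_embed (submxrow d i).
Proof. by rewrite submxrowZ linearZ. Qed.

(** A unilateral deviation is an affine move: this turns statements about
    [deviate] into linear algebra. *)
Lemma deviateE x i (z : 'rV[R]_(n i)) :
  deviate x z = x + block_embed (z - submxrow x i).
Proof.
apply/mxrowP => j; rewrite submxrowD /block_embed /deviate !mxrowK.
have [<-|ij] := eqVneq i j; first by rewrite !dfwithin addrC subrK.
by rewrite !dfwithout// submxrow0 addr0.
Qed.

Lemma deviate_self x i : deviate x (submxrow x i) = x.
Proof. by rewrite deviateE subrr raddf0 addr0. Qed.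

Lemma supnorm_block_le d i : `|block_embed (submxrow d i)| <= `|d|.
Proof.
have entry j (p : 'I_(n j)) :
    `|dfwith (fun l => submxrow (0 : profile) l) i (submxrow d i) j 0 p|
    <= `|d|.
  move: p; case: dfwithP => [|l _] p; last by rewrite submxrow0 mxE normr0.
  by rewrite mxE supnorm_coord.
have [->|b0] := eqVneq `|block_embed (submxrow d i)| 0; first exact: normr_ge0.
have [[k l] nb] := mx_norm_neq0 b0.
by rewrite [leLHS]nb /= (ord1 k) mxE; exact: entry.
Qed.

(** The block projections do not increase the sup norm. *)
Lemma continuous_block i : continuous (fun d => block_embed (submxrow d i)).
Proof.
move=> d; apply/(@cvgrPdist_lt _ _ _ (nbhs d)) => e e0.
apply/nbhs_ballP; exists e => // y; rewrite -ball_normE /= => dy.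
rewrite -raddfB -submxrowB; exact: le_lt_trans (supnorm_block_le _ _) dy.
Qed.

(** The partial gradient represents the differential of [theta i] along the
    moves of player [i]. *)
Lemma partial_gradientE theta i x (z : 'rV[R]_(n i)) :
  differentiable (theta i) x ->
  dotp (partial_gradient theta i x) z = 'd (theta i) x (block_embed z).
Proof.
move=> dx; rewrite [in RHS](row_sum_delta z) !linear_sum /dotp.
apply: eq_bigr => j _; rewrite !linearZ mulrC /=.
suff -> : partial_gradient theta i x 0 j =
  'd (theta i) x (block_embed 'e_j) by [].
rewrite mxE -(deriveE _ dx) /derive.
have -> // : (fun h : R => h^-1 *:
    (((fun z => theta i (deviate x z)) \o shift (submxrow x i)) (h *: 'e_j)
     - theta i (deviate x (submxrow x i)))) =
  (fun h : R => h^-1 *: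
    ((theta i \o shift x) (h *: block_embed 'e_j) - theta i x)).
apply/funext => h /=.
by rewrite deviate_self deviateE addrK linearZ [x + _]addrC.
Qed.

Lemma psiE theta a x y :
  psi theta a x y =
    \sum_(i < N) (theta i x - theta i (x + block_embed (submxrow (y - x) i)))
    - a / 2 * dotp (x - y) (x - y).
Proof.
rewrite dotp_blocks mulr_sumr -sumrB; apply: eq_bigr => i _.
by rewrite deviateE -submxrowB sqr_enorm !submxrowB.
Qed.

Lemma psi_continuous (T : topologicalType) theta a (f g : T -> profile) z :
  (forall i, continuous (theta i)) ->
  {for z, continuous f} -> {for z, continuous g} ->
  {for z, continuous (fun z => psi theta a (f z) (g z))}.
Proof.
move=> ctheta cf cg; have -> : (fun z => psi theta a (f z) (g z)) = fun z =>
    \sum_(i < N)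
      (theta i (f z) - theta i (f z + block_embed (submxrow (g z - f z) i)))
    - a / 2 * dotp (f z - g z) (f z - g z).
  by apply/funext => z'; exact: psiE.
apply: continuousB; last first.
  apply: continuousM; first exact: cst_continuous.
  apply: (@continuous_comp _ _ _ (fun z => f z - g z) (fun u => dotp u u)).
    exact: continuousB.
  exact: continuous_sqdist.
apply: continuous_sum => i.
apply: (@continuousB _ _ _ (theta i \o f) (theta i \o
    (fun z => f z + block_embed (submxrow (g z - f z) i)))).
  by apply: continuous_comp => //; exact: ctheta.
apply: continuous_comp; last exact: ctheta.
have cmove :
    {for z, continuous (fun z => block_embed (submxrow (g z - f z) i))}.
  apply: (@continuous_comp _ _ _ (fun z => g z - f z)
    (fun d => block_embed (submxrow d i))); first exact: continuousB.
  exact: continuous_block.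
exact: (continuousD cf cmove).
Qed.

(** Moving along [d] changes [theta i x] through all blocks of [d], and the
    loss of the unilateral deviation, whose block [i] is pinned, through all
    blocks but the [i]-th: block [i] alone survives in the difference. *)
Lemma psi_derivel theta a x d : (forall i, differentiable (theta i) x) ->
  is_derive (0 : R) 1 (fun t => psi theta a (x + t *: d) x)
    (dotp (pseudo_gradient theta x) d).
Proof.
move=> dtheta.
have -> : dotp (pseudo_gradient theta x) d =
    \sum_(i < N) ('d (theta i) x d -
      'd (theta i) x (d - block_embed (submxrow d i))) - a / 2 * 0 * dotp d d.
  rewrite mulr0 mul0r subr0 dotp_blocks; apply: eq_bigr => i _.
  by rewrite mxrowK partial_gradientE// linearB opprB addrC subrK.
rewrite (_ : (fun t => _) = (\sum_(i < N) ((fun t => theta i (x + t *: d)) -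
    (fun t => theta i (x + t *: (d - block_embed (submxrow d i))))))
    - (fun t => a / 2 * t ^+ 2 * dotp d d)).
  apply: is_deriveB; last exact: is_derive_sq_scale.
  by apply: is_derive_sum => i; apply: is_deriveB; exact: is_derive_line.
apply/funext => t; rewrite psiE !fctE fct_sumE; congr (_ - _).
  apply: eq_bigr => i _; congr (_ - theta i _).
  have -> : x - (x + t *: d) = (- t) *: d by rewrite opprD addNKr scaleNr.
  by rewrite block_embedZ scaleNr scalerBr addrA.
by rewrite addrAC subrr add0r dotpZl dotpZr expr2 !mulrA.
Qed.

Lemma psi_deriver theta a x d : (forall i, differentiable (theta i) x) ->
  is_derive (0 : R) 1 (fun t => psi theta a x (x + t *: d))
    (- dotp (pseudo_gradient theta x) d).
Proof.
move=> dtheta.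
have -> : - dotp (pseudo_gradient theta x) d =
    \sum_(i < N) (0 - 'd (theta i) x (block_embed (submxrow d i)))
    - a / 2 * 0 * dotp d d.
  rewrite mulr0 mul0r subr0 dotp_blocks -sumrN; apply: eq_bigr => i _.
  by rewrite mxrowK partial_gradientE// sub0r.
rewrite (_ : (fun t => _) = (\sum_(i < N) (cst (theta i x) -
    (fun t => theta i (x + t *: block_embed (submxrow d i)))))
    - (fun t => a / 2 * t ^+ 2 * dotp d d)).
  apply: is_deriveB; last exact: is_derive_sq_scale.
  by apply: is_derive_sum => i; apply: is_deriveB; exact: is_derive_line.
apply/funext => t; rewrite psiE !fctE fct_sumE; congr (_ - _).
  apply: eq_bigr => i _; congr (_ - theta i _).
  by rewrite addrAC subrr add0r block_embedZ.
by rewrite opprD addNKr dotpNl dotpNr opprK dotpZl dotpZr expr2 !mulrA.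
Qed.

(** Convexity of each loss in its own block gives concavity; the proximal term
    is a quadratic, so it meets the strong concavity inequality with
    equality. *)
Lemma psi_concaver theta a x y y' t :
  (forall i x, convex_function (E := 'rV[R]_(n i)) setT
     (fun z => theta i (deviate x z))) -> 0 < t < 1 ->
  (1 - t) * psi theta a x y + t * psi theta a x y'
      + a / 2 * (t * (1 - t)) * dotp (y' - y) (y' - y)
    <= psi theta a x (y + t *: (y' - y)).
Proof.
move=> cvx t01; rewrite !psiE.
set S := (X in (1 - t) * (X - _)); set S' := (X in t * (X - _)).
set S'' := (X in _ <= X - _).
have SS : (1 - t) * S + t * S' <= S''.
  rewrite /S /S' /S'' !mulr_sumr -big_split; apply: ler_sum => i _ /=.
  have := convex_function_segment (cvx i x) (x := submxrow y i)
    (y := submxrow y' i) I I t01.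
  rewrite !deviateE !submxrowB !submxrowD submxrowZ submxrowB.
  set p := theta i (x + block_embed (_ + _ - _)); lra.
have -> : dotp (x - (y + t *: (y' - y))) (x - (y + t *: (y' - y))) =
  (1 - t) * dotp (x - y) (x - y) + t * dotp (x - y') (x - y')
  - t * (1 - t) * dotp (y' - y) (y' - y).
  rewrite !(dotpDl, dotpDr, dotpNl, dotpNr, dotpZl, dotpZr).
  rewrite (dotpC y x) (dotpC y' x) (dotpC y' y); ring.
move: SS; set D := dotp (x - y) _; set D' := dotp (x - y') _.
set D'' := dotp (y' - y) _; lra.
Qed.

Lemma psi_gap_bifunction (X : set profile) theta a :
  (forall i x, differentiable (theta i) x) ->
  (forall i x, convex_function (E := 'rV[R]_(n i)) setT
     (fun z => theta i (deviate x z))) ->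
  (forall y, X y -> convex_function (E := profile) X
     (fun x => psi theta a x y)) ->
  gap_bifunction X (psi theta a) (pseudo_gradient theta) a.
Proof.
move=> dtheta cvx pcvx.
have ctheta i : continuous (theta i).
  by move=> x; exact: differentiable_continuous.
split.
- move=> x; rewrite psiE subrr dotp0r mulr0 subr0 big1// => i _.
  by rewrite submxrow0 raddf0 addr0 subrr.
- move=> x x' y t Xx Xx' Xy t01.
  exact: convex_function_segment (pcvx y Xy) _ _ _.
- by move=> x y y' t t01; exact: psi_concaver.
- move=> y x; apply: (@psi_continuous _ theta a id (cst y) x ctheta) => //.
  exact: cst_continuous.
- move=> x y; apply: (@psi_continuous _ theta a (cst x) id y ctheta) => //.
  exact: cst_continuous.
- by move=> x d; exact: psi_derivel.
- by move=> x d; exact: psi_deriver.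
Qed.

End Blocks.

(** * Weak sharpness and the error bound *)

Unset Implicit Arguments.

Theorem theorem3p1 (R : realType) (N : nat) (n : 'I_N -> nat)
    (X : set 'rV[R]_(\sum_(i < N) n i))
    (theta : 'I_N -> 'rV[R]_(\sum_(i < N) n i) -> R) (a : R)
    (X_nonempty : X !=set0) (X_closed : closed X) (X_convex : convex_set X)
    (theta_C1 : forall i, continuously_differentiable (theta i))
    (theta_convex : forall (i : 'I_N) (x : 'rV[R]_(\sum_(i < N) n i)),
       convex_function (E := 'rV[R]_(n i)) setT
         (fun z => theta i (deviate x z)))
    (a_gt0 : 0 < a)
    (psi_convex : forall y, X y ->
       convex_function (E := 'rV[R]_(\sum_(i < N) n i)) X
         (fun x => psi theta a x y)) :
  weak_sharpness X theta <->
  exists2 gamma : R, 0 < gamma &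
    forall x, X x ->
      (gamma%:E * edistance x (NNE X theta) <= regularized_gap X theta a x)%E.
Proof.
have gb : gap_bifunction X (psi theta a) (pseudo_gradient theta) a.
  by apply: psi_gap_bifunction => // i x; case: (theta_C1 i).
have [xs sol] := gap_solution_exists a_gt0 gb X_nonempty X_closed X_convex.
have NNE1 : NNE X theta = [set xs].
  apply/seteqP; split=> [x xsol|_ ->]; last exact: sol.
  exact: gap_solution_unique a_gt0 gb xsol sol.
have Xxs : X xs by case: sol.
rewrite /weak_sharpness NNE1; split=> -[g g0 H]; exists g => //.
  move=> x Xx; have := H xs erefl; rewrite bigcap_set1.
  move=> /(sharp_cone_growth _ _ g0) growth.
  rewrite edistance_set1 -EFinM; apply: ereal_sup_ge.
  exists (psi theta a x xs)%:E; first by exists xs.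
  rewrite lee_fin; apply: le_trans (growth x Xx) _.
  exact: gap_lower_bound gb Xx Xxs.
move=> _ ->; rewrite bigcap_set1; apply/(sharp_cone_growth _ _ g0).
apply: (gap_error_bound_slope a_gt0 gb) => // x Xx.
have [y Xy ymax] := gap_argmax x a_gt0 gb X_nonempty X_closed.
exists y => //; rewrite -lee_fin EFinM -edistance_set1.
apply: le_trans (H x Xx) _; apply: ge_ereal_sup => _ [z Xz <-].
by rewrite lee_fin; exact: ymax.
Qed.
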